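(* If $X$ is a proper metric space then there is a homeomorphism $\nu'(X)\to\nu(X)$, where $\nu(X)$ is the Higson corona of $X$. If $f:X\to Y$ is a coarse map between proper metric spaces then $\nu'(f)$ and $\nu(f)$ are homeomorphic, i.e. they are the same map up to pre- and postcomposition with homeomorphisms: there are homeomorphisms $\alpha:\nu'(X)\to\nu(X)$ and $\beta:\nu'(Y)\to\nu(Y)$ with $\nu(f)\circ\alpha=\beta\circ\nu'(f)$.
   Context: Metrics take finite values. A subset $E\subseteq X\times X$ of a metric space $(X,d)$ is an entourage if $\sup_{(x,y)\in E}d(x,y)<\infty$. For $A\subseteq X$ write $E[A]=\{x\in X:(x,a)\in E\text{ for some }a\in A\}$. A map $f:X\to Y$ between metric spaces is coarse if $(f\times f)(E)$ is an entourage of $Y$ for every entourage $E$ of $X$, and $f^{-1}(B)$ is bounded for every bounded $B\subseteq Y$. For $A,B\subseteq X$ write $A\curlywedge B$ if there is an entourage $E$ of $X$ such that $E[A]\cap E[B]$ is not bounded. A coarse ultrafilter on $X$ is a system $\mathcal F$ of subsets of $X$ such that: (1) $A,B\in\mathcal F$ implies $A\curlywedge B$; (2) if $A,B\subseteq X$ and $A\cup B\in\mathcal F$ then $A\in\mathcal F$ or $B\in\mathcal F$; (3) $X\in\mathcal F$. Two coarse ultrafilters $\mathcal F,\mathcal G$ on $X$ are asymptotically alike, $\mathcal F\lambda\mathcal G$, if $A\curlywedge B$ for all $A\in\mathcal F$, $B\in\mathcal G$; this is an equivalence relation. The corona $\nu'(X)$ is the set of coarse ultrafilters on $X$ modulo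 $\lambda$, with the topology generated by the complements of the sets $\mathrm{cl}(A)=\{[\mathcal F]\in\nu'(X):A\in\mathcal F\}$, $A\subseteq X$. For a coarse map $f:X\to Y$, $\nu'(f):\nu'(X)\to\nu'(Y)$ is the continuous map $[\mathcal F]\mapsto[f_*\mathcal F]$, where $f_*\mathcal F=\{A\subseteq Y:f^{-1}(A)\in\mathcal F\}$. Higson corona: a bounded continuous function $\varphi:X\to\mathbb R$ on a proper metric space is a Higson function if for every entourage $E$ the restriction to $E$ of $d\varphi(x,y)=\varphi(y)-\varphi(x)$ vanishes at infinity. Let $C_h(X)$ be the algebra of Higson functions and $e:X\to\mathbb R^{C_h(X)}$, $x\mapsto(\varphi(x))_\varphi$, the evaluation embedding. The Higson corona is $\nu(X)=\overline{e(X)}\setminus e(X)$, i.e. the boundary of the compactification of $X$ determined by $C_h(X)$. For a coarse map $f:X\to Y$ between proper metric spaces, $\nu(f):\nu(X)\to\nu(Y)$ is the induced map on Higson coronas: for $\varphi\in C_h(Y)$ the function $\varphi\circ f$ agrees, up to a function vanishing at infinity, with some $\psi\in C_h(X)$ (one can take $\psi=\varphi\circ f$ if $f$ is continuous), and $\nu(f)$ sends $(x_\psi)_{\psi\in C_h(X)}$ to the point whose $\varphi$-coordinate is $x_{\psi}$ for such $\psi$. *)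

(* Defs.v *)
From HB Require Import structures.
From mathcomp Require Import all_boot all_order all_algebra.
From mathcomp Require Import generic_quotient.
From mathcomp Require Import all_classical all_reals all_analysis.
From mathcomp Require Import lra.
Set Implicit Arguments.
Unset Strict Implicit.
Unset Printing Implicit Defensive.
Import Order.TTheory GRing.Theory Num.Theory numFieldNormedType.Exports.
Local Open Scope classical_set_scope.
Local Open Scope ring_scope.
Local Open Scope quotient_scope.

Definition homeomorphism (S T : topologicalType) (f : S -> T) :=
  continuous f /\ exists g : T -> S, [/\ cancel f g, cancel g f & continuous g].

Section CoarseSpace.
Context {R : realType}.
Implicit Types X Y : metricType R.

Definition metric_bounded X (B : set X) :=
  exists M : R, forall x y, B x -> B y -> mdist x y <= M.

Definition proper_metric X :=
  forall B : set X, closed B -> metric_bounded B -> compact B.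

(* Not to be confused with the uniform entourages [entourage] of the library. *)
Definition coarse_entourage X (E : set (X * X)) :=
  exists M : R, forall p, E p -> mdist p.1 p.2 <= M.

Definition thicken X (E : set (X * X)) (A : set X) : set X :=
  [set x | exists2 a, A a & E (x, a)].

Definition coarse_map X Y (f : X -> Y) :=
  (forall E, coarse_entourage E ->
     coarse_entourage [set (f p.1, f p.2) | p in E]) /\
  (forall B, metric_bounded B -> metric_bounded (f @^-1` B)).

Definition close X (A B : set X) :=
  exists2 E, coarse_entourage E &
    ~ metric_bounded (thicken E A `&` thicken E B).

Record coarse_ultrafilter X := CoarseUltrafilter {
  cuf_sets :> set X -> Prop ;
  cuf_close : forall A B, cuf_sets A -> cuf_sets B -> close A B ;
  cuf_prime : forall A B, cuf_sets (A `|` B) -> cuf_sets A \/ cuf_sets B ;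
  cuf_setT : cuf_sets setT }.

Definition asymptotically_alike X (F G : coarse_ultrafilter X) :=
  forall A B, F A -> G B -> close A B.

End CoarseSpace.

HB.instance Definition _ (R : realType) (X : metricType R) :=
  gen_eqMixin (coarse_ultrafilter X).
HB.instance Definition _ (R : realType) (X : metricType R) :=
  gen_choiceMixin (coarse_ultrafilter X).

Section Alike.
Context {R : realType}.
Implicit Types X Y : metricType R.

Lemma closeC X (A B : set X) : close A B -> close B A.
Proof. by case=> E bE nb; exists E => //; rewrite setIC. Qed.

Lemma metric_boundedS X (A B : set X) :
  A `<=` B -> metric_bounded B -> metric_bounded A.
Proof. by move=> AB [M hM]; exists M => x y /AB Bx /AB; exact: hM. Qed.

Lemma closePn X (A B : set X) : ~ close A B <->
  forall M : R, metric_bounded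
    [set p | exists a b, [/\ A a, B b, mdist p a <= M & mdist p b <= M]].
Proof.
split=> [nAB M|bd [E [M hM]] nb].
  apply: contrapT => nb; apply: nAB.
  exists [set p | mdist p.1 p.2 <= M]; first by exists M.
  move=> b; apply: nb; apply: metric_boundedS b => p [a [b [Aa Bb pa pb]]].
  by split; [exists a|exists b].
apply: nb; apply: metric_boundedS (bd M) => p [[a Aa Ea] [b Bb Eb]].
by exists a, b; split => //; [exact: hM Ea|exact: hM Eb].
Qed.

(* Coarse normality: the point of transitivity of [asymptotically_alike]. *)
Lemma close_separation X (A C : set X) : ~ close A C ->
  exists B, ~ close A B /\ ~ close (~` B) C.
Proof.
move=> /closePn nAC.
exists [set x | forall a, A a -> exists2 c, C c & mdist x c <= mdist x a].
split; apply/closePn => M.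
  apply: metric_boundedS (nAC (M + (M + M))) => p [a [b [Aa Bb pa pb]]].
  have M0 : 0 <= M by apply: le_trans pa; exact: mdist_ge0.
  have [c Cc bc] := Bb a Aa.
  exists a, c; split => //; first by lra.
  have := metric_triangle p b c; have := metric_triangle b p a.
  by rewrite (metric_sym b p); lra.
apply: metric_boundedS (nAC (M + (M + M))) => p [b [c [nBb Cc pb pc]]].
have M0 : 0 <= M by apply: le_trans pb; exact: mdist_ge0.
have [a Aa ba] : exists2 a, A a & forall c, C c -> mdist b a <= mdist b c.
  apply: contrapT => na; apply: nBb => a Aa; apply: contrapT => nc.
  apply: na; exists a => // c' Cc'; rewrite leNgt; apply/negP => lt.
  by apply: nc; exists c' => //; exact: ltW.
exists a, c; split => //; last by lra.
have := metric_triangle p b a; have := metric_triangle b p c.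
by have := ba c Cc; rewrite (metric_sym b p); lra.
Qed.

Variable X : metricType R.
Implicit Types F G H : coarse_ultrafilter X.

Let alike : rel (coarse_ultrafilter X) :=
  fun F G => `[< asymptotically_alike F G >].

Let alike_refl : reflexive alike.
Proof. by move=> F; apply/asboolP => A B; exact: cuf_close. Qed.

Let alike_sym : symmetric alike.
Proof.
by move=> F G; apply/asboolP/asboolP => FG A B FA GB; apply/closeC/FG.
Qed.

Let alike_trans : transitive alike.
Proof.
move=> G F H /asboolP FG /asboolP GH; apply/asboolP => A C FA HC.
apply: contrapT => /close_separation[B [nAB nBC]].
have : G (B `|` ~` B) by rewrite setUv; exact: cuf_setT.
by case/cuf_prime => GB; [exact/nAB/FG|exact/nBC/GH].
Qed.

Definition alike_rel : equiv_rel (coarse_ultrafilter X) :=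
  EquivRel alike alike_refl alike_sym alike_trans.

Definition coarse_corona := {eq_quot alike_rel}.

HB.instance Definition _ := EqQuotient.on coarse_corona.
HB.instance Definition _ := Choice.on coarse_corona.

Definition corona_class F : coarse_corona := \pi_coarse_corona F.

Lemma corona_classP F G :
  corona_class F = corona_class G <-> asymptotically_alike F G.
Proof.
split=> [/eqmodP/asboolP //|FG]; apply/eqmodP; exact/asboolP.
Qed.

(* Membership is not invariant under [asymptotically_alike]: a class lies in
   [corona_cl A] as soon as one of its representatives contains [A]. *)
Definition corona_cl (A : set X) : set coarse_corona :=
  [set corona_class F | F in [set F : coarse_ultrafilter X | F A]].

HB.instance Definition _ := @isSubBaseTopological.Build coarse_corona
  (set X) setT (fun A => ~` corona_cl A).

End Alike.

Section CoarseCoronaMap.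
Context {R : realType} {X Y : metricType R}.

Lemma coarse_map_close (f : X -> Y) (A B : set Y) : coarse_map f ->
  close (f @^-1` A) (f @^-1` B) -> close A B.
Proof.
move=> [fE fB] [E bE nb]; exists [set (f p.1, f p.2) | p in E]; first exact: fE.
move=> /fB b; apply: nb; apply: metric_boundedS b.
by move=> x [[a Aa Ea] [b Bb Eb]]; split;
  [exists (f a)|exists (f b)] => //; [exists (x, a)|exists (x, b)].
Qed.

Variables (f : X -> Y) (cf : coarse_map f).

Definition cuf_pushforward (F : coarse_ultrafilter X) : coarse_ultrafilter Y :=
  @CoarseUltrafilter R Y [set A | F (f @^-1` A)]
    (fun A B FA FB => coarse_map_close cf (cuf_close FA FB))
    (fun A B => @cuf_prime R X F (f @^-1` A) (f @^-1` B)) (cuf_setT F).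

Definition coarse_corona_map (c : coarse_corona X) : coarse_corona Y :=
  corona_class (cuf_pushforward (repr c)).

Lemma coarse_corona_mapE F :
  coarse_corona_map (corona_class F) = corona_class (cuf_pushforward F).
Proof.
apply/corona_classP => A B FA FB; apply: (coarse_map_close cf).
have /corona_classP : corona_class (repr (corona_class F)) = corona_class F.
  exact: reprK.
exact.
Qed.

End CoarseCoronaMap.

(* [K] is compact in the ambient space [T] rather than in [D]: an entourage of
   [X] is not assumed closed in [X * X]. *)
Definition vanishes_at_infinity {R : realType} (T : topologicalType)
    (D : set T) (g : T -> R) :=
  forall eps : R, 0 < eps ->
    exists2 K, compact K & forall t, D t -> ~ K t -> `|g t| < eps.

(* Only the underlying set of the algebra C_h(X) matters below. *)
Definition higson {R : realType} (X : metricType R) : set (X -> R) :=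
  [set phi | [/\ bounded_fun phi, continuous phi &
    forall E : set (X * X), coarse_entourage E ->
      vanishes_at_infinity E (fun p => phi p.2 - phi p.1)]].
Arguments higson {R} X _.

Definition higson_eval {R : realType} (X : metricType R) (x : X) :
    {ptws higson X -> R} :=
  fun phi => set_val phi x.

Definition higson_boundary {R : realType} (X : metricType R) :
    set {ptws higson X -> R} :=
  closure (range (@higson_eval R X)) `\` range (@higson_eval R X).
Arguments higson_boundary {R} X _.

Definition higson_corona {R : realType} (X : metricType R) :=
  set_type (higson_boundary X).

HB.instance Definition _ (R : realType) (X : metricType R) :=
  Topological.on (higson_corona X).

(* [psi] represents the pullback of [phi] along the coarse, possibly
   discontinuous map [f]. *)
Definition higson_pullback {R : realType} (X Y : metricType R) (f : X -> Y)
    (phi : higson Y) (psi : higson X) :=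
  vanishes_at_infinity setT (fun x => set_val phi (f x) - set_val psi x).

Section ProperSpace.
Context {R : realType}.
Implicit Types X Y : metricType R.

Lemma compact_metric_bounded X (K : set X) : compact K -> metric_bounded K.
Proof.
move=> cK; have [[x0 _]|/forallNP K0] := pselect (exists x, K x); last first.
  by exists 0 => x y /K0.
move/compact_near_coveringP : cK => /(_ R +oo (fun M x => mdist x0 x <= M)).
case=> [x _|M [_ hM]].
  exists (ball x 1, [set M | mdist x0 x + 1 < M]) => /=.
    by split; [exact: nbhsx_ballx|exists (mdist x0 x + 1); rewrite num_real].
  move=> [y M] /= [+ xM]; rewrite ballEmdist /= => yx.
  by have := metric_triangle x0 x y; lra.
exists ((M + 1) + (M + 1)) => x y Kx Ky.
have := metric_triangle x x0 y; rewrite (metric_sym x x0).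
have M1 : M < M + 1 by lra.
by have := hM _ M1 x Kx; have := hM _ M1 y Ky; lra.
Qed.

Lemma metric_bounded_closure X (B : set X) :
  metric_bounded B -> metric_bounded (closure B).
Proof.
move=> [M hM]; exists (M + 2) => x y cx cy.
have [x' [Bx' ]] := cx _ (nbhsx_ballx x 1 ltr01).
have [y' [By' ]] := cy _ (nbhsx_ballx y 1 ltr01).
rewrite !ballEmdist /= => yy' xx'; have := hM _ _ Bx' By'.
have := metric_triangle x x' y; have := metric_triangle x' y' y.
by rewrite (metric_sym y' y); lra.
Qed.

Lemma proper_compact_closure X (B : set X) :
  proper_metric X -> metric_bounded B -> compact (closure B).
Proof.
by move=> pX bB; apply: pX; [exact: closed_closure|exact: metric_bounded_closure].
Qed.

Lemma metric_boundedU X (B B' : set X) :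
  metric_bounded B -> metric_bounded B' -> metric_bounded (B `|` B').
Proof.
move=> bB bB'; have [[b Bb]|/forallNP nB] := pselect (exists b, B b); last first.
  by apply: metric_boundedS bB' => x [/nB|].
have [[b' Bb']|/forallNP nB'] := pselect (exists b, B' b); last first.
  by apply: metric_boundedS bB => x [|/nB'].
case: bB bB' => N hN [N' hN'].
suff h x : (B `|` B') x -> mdist b x <= `|N| + mdist b b' + `|N'|.
  exists ((`|N| + mdist b b' + `|N'|) + (`|N| + mdist b b' + `|N'|)) => x y.
  move=> /h hx /h hy.
  by have := metric_triangle x b y; rewrite (metric_sym x b); lra.
have d0 := mdist_ge0 b b'; have := ler_norm N; have := ler_norm N'.
have := normr_ge0 N; have := normr_ge0 N' => n0' n0 lN' lN.
case=> [Bx|Bx]; first by have := hN _ _ Bb Bx; lra.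
by have := hN' _ _ Bb' Bx; have := metric_triangle b b' x; lra.
Qed.

Lemma metric_bounded_nbhd X (B : set X) (M : R) : metric_bounded B ->
  metric_bounded [set y | exists2 x, B x & mdist x y <= M].
Proof.
move=> [N hN]; exists (M + N + M) => y y' [x Bx xy] [x' Bx' xy'].
have := hN x x' Bx Bx'; have := metric_triangle y x y'.
by have := metric_triangle x x' y'; rewrite (metric_sym y x); lra.
Qed.

Lemma bounded_fun_le (T : Type) (g : T -> R) :
  bounded_fun g <-> exists C : R, forall x, `|g x| <= C.
Proof.
split=> [[M [_ hM]]|[C hC]].
  by exists (M + 1) => x; apply: hM => //; rewrite ltrDl.
by exists C; split=> [|M /ltW CM x _ /=]; [exact: num_real|exact: le_trans CM].
Qed.

Definition slowly_varying X (g : X -> R) := forall M eps : R, 0 < eps ->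
  exists2 B, metric_bounded B &
    forall x y, ~ B x -> mdist x y <= M -> `|g y - g x| < eps.

Lemma vanishes_diffP X (g : X -> R) : proper_metric X ->
  (forall E : set (X * X), coarse_entourage E ->
     vanishes_at_infinity E (fun p => g p.2 - g p.1)) <-> slowly_varying g.
Proof.
move=> pX; split=> [hg M eps e0|hg E [M hM] eps e0].
  have [|K cK hK] := hg [set p | mdist p.1 p.2 <= M] _ eps e0; first by exists M.
  exists (fst @` K).
    apply: compact_metric_bounded; apply: continuous_compact cK.
    by apply: continuous_subspaceT => p; exact: cvg_fst.
  move=> x y nx xy; apply: (hK (x, y)) => // Kxy.
  by apply: nx; exists (x, y).
have [B bB hB] := hg M eps e0.
exists (closure B `*` closure [set y | exists2 x, B x & mdist x y <= M]).
  apply: compact_setX; apply: proper_compact_closure => //.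
  exact: metric_bounded_nbhd.
move=> [x y] /= Exy nK; apply: hB (hM _ Exy) => Bx; apply: nK; split => /=.
  exact: subset_closure.
by apply: subset_closure; exists x => //; exact: (hM _ Exy).
Qed.

Lemma slowly_varying_comp X Y (f : X -> Y) (g : Y -> R) :
  coarse_map f -> slowly_varying g -> slowly_varying (g \o f).
Proof.
move=> [fE fB] hg M eps e0.
have [|N hN] := fE [set p | mdist p.1 p.2 <= M]; first by exists M.
have [B bB hB] := hg N eps e0; exists (f @^-1` B); first exact: fB.
by move=> x y nx xy; apply: hB => //; apply: (hN (f x, f y)); exists (x, y).
Qed.

(* Every bounded slowly varying function is, up to a function vanishing at
   infinity, Lipschitz: take the infimal convolution with a large multiple of
   the distance. *)
Lemma slowly_varying_regularize X (g : X -> R) :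
  proper_metric X -> bounded_fun g -> slowly_varying g ->
  exists2 psi : X -> R, higson X psi &
    vanishes_at_infinity setT (fun x => g x - psi x).
Proof.
move=> pX /bounded_fun_le[C0 hC0] sg.
have [C C_gt0 hC] : exists2 C, 0 < C & forall x, `|g x| <= C.
  exists (`|C0| + 1) => [|x]; first by rewrite ltr_wpDl.
  by have := hC0 x; have := ler_norm C0; lra.
have gC x : - C <= g x <= C by rewrite -ler_norml.
pose S x := [set g y + 2 * C * mdist x y | y in [set: X]].
pose psi x := inf (S x).
have lbS x : lbound (S x) (- C).
  move=> _ [y _ <-]; have := gC y; have := mdist_ge0 x y => d0 g0.
  by have : 0 <= 2 * C * mdist x y; [rewrite !mulr_ge0 // ltW|lra].
have psi_le x y : psi x <= g y + 2 * C * mdist x y.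
  by apply: ge_inf; [exists (- C)|exists y].
have psi_leg x : psi x <= g x by have := psi_le x x; rewrite mdistxx mulr0 addr0.
have le_psi x r : (forall y, r <= g y + 2 * C * mdist x y) -> r <= psi x.
  move=> h; apply: lb_le_inf => [|_ [y _ <-]//].
  by exists (g x + 2 * C * mdist x x); exists x.
have psi_geC x : - C <= psi x by apply: le_psi => y; apply: lbS; exists y.
have lip x y : psi x <= psi y + 2 * C * mdist x y.
  rewrite -lerBlDr; apply: le_psi => z; rewrite lerBlDr.
  apply: le_trans (psi_le x z) _; rewrite -addrA lerD2l -mulrDr ler_pM2l; last lra.
  by rewrite addrC metric_triangle.
have dlip x y : `|psi x - psi y| <= 2 * C * mdist x y.
  rewrite ler_norml; have := lip x y; have := lip y x.
  by rewrite (metric_sym y x); lra.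
have close1 eps : 0 < eps -> exists2 B, metric_bounded B &
    forall x, ~ B x -> `|g x - psi x| < eps.
  move=> e0; have e20 : 0 < eps / 2 by rewrite divr_gt0.
  have [B bB hB] := sg 1 _ e20; exists B => // x nBx.
  rewrite ger0_norm ?subr_ge0 //.
  have : g x - eps / 2 <= psi x; last by lra.
  apply: le_psi => y; have d0 := mdist_ge0 x y.
  have [xy|xy] := leP (mdist x y) 1.
    have := hB x y nBx xy; rewrite ltr_norml.
    have : 0 <= 2 * C * mdist x y by rewrite !mulr_ge0 // ltW.
    by lra.
  have : 2 * C * 1 <= 2 * C * mdist x y by rewrite ler_pM2l ?ltW //; lra.
  by have := gC x; have := gC y; lra.
exists psi; last first.
  move=> eps e0; have [B bB hB] := close1 eps e0.
  exists (closure B); first exact: proper_compact_closure.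
  by move=> x _ nB; apply: hB => /subset_closure.
split.
- apply/bounded_fun_le; exists C => x; rewrite ler_norml psi_geC /=.
  by apply: le_trans (psi_leg x) _; have /andP[] := gC x.
- move=> x; apply/cvgrPdist_lt => e e0.
  have d0 : 0 < e / (2 * C) by rewrite divr_gt0 // mulr_gt0.
  near=> y; apply: le_lt_trans (dlip x y) _; rewrite mulrC -ltr_pdivlMr ?mulr_gt0 //.
  have : ball x (e / (2 * C)) y by near: y; exact: nbhsx_ballx.
  by rewrite ballEmdist.
- apply/vanishes_diffP => // M eps e0; have e30 : 0 < eps / 3 by rewrite divr_gt0.
  have [B bB hB] := close1 _ e30; have [B' bB' hB'] := sg M _ e30.
  have [K bK [BK B'K]] : exists2 K, metric_bounded K & B `<=` K /\ B' `<=` K.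
    by exists (B `|` B'); [exact: metric_boundedU|split=> z; [left|right]].
  exists [set y | exists2 x, K x & mdist x y <= `|M|].
    exact: metric_bounded_nbhd.
  move=> x y nKx xy; have nK z : mdist x z <= M -> ~ K z.
    move=> xz Kz; apply: nKx; exists z => //.
    by rewrite metric_sym (le_trans xz) // ler_norm.
  have M0 : 0 <= M := le_trans (mdist_ge0 _ _) xy.
  have nx : ~ K x by apply: nK; rewrite mdistxx.
  have {nK}ny := nK y xy.
  have := hB x (fun h => nx (BK _ h)).
  have := hB y (fun h => ny (BK _ h)).
  have := hB' x y (fun h => nx (B'K _ h)) xy.
  by rewrite !ltr_norml; lra.
Unshelve. all: by end_near. Qed.

End ProperSpace.

Section HigsonMap.
Context {R : realType}.
Implicit Types X Y : metricType R.

Lemma ptws_cvgP (S I : Type) (F : set_system S) {FF : Filter F}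
    (h : S -> {ptws I -> R}) (z : {ptws I -> R}) :
  h @ F --> z <-> forall i, (fun s => h s i) @ F --> z i.
Proof.
split=> [/cvg_sup hz i|hz]; last apply/cvg_sup => i.
  exact: (cvg_comp _ (fun g : I -> R => g i) (hz i)
    (@initial_continuous _ _ (fun g : I -> R => g i) z)).
move=> A /= [_ [[B oB <-] Bz] BA]; have /hz : nbhs (z i) B by exact: open_nbhs_nbhs.
rewrite !nbhs_simpl /=; apply: (@filterS _ F) => s Bs; exact: BA.
Qed.

Lemma higson_eval_continuous X : continuous (@higson_eval R X).
Proof.
move=> x; apply/ptws_cvgP => phi; have [_ + _] := set_valP phi; exact.
Qed.

(* The neighbourhood filter of a boundary point, traced on the complements of
   compact subsets. *)
Definition boundary_trace X (z : higson_corona X) : set_system X :=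
  [set S | exists2 K, compact K &
    nbhs (set_val z) [set w | forall x, w = higson_eval x -> ~ K x -> S x]].


#[local] Instance boundary_trace_proper X (z : higson_corona X) :
  ProperFilter (boundary_trace z).
Proof.
have [clz nz] : higson_boundary X (set_val z) := set_valP z.
split.
  move=> [K cK zK]; have cev : closed (@higson_eval R X @` K).
    apply: compact_closed.
      apply: (@hausdorff_product (higson X) (fun=> R)) => _; exact: Rhausdorff.
    apply: continuous_compact cK; apply: continuous_subspaceT.
    exact: higson_eval_continuous.
  have oz : nbhs (set_val z) (~` (@higson_eval R X @` K)).
    apply: open_nbhs_nbhs; split; first exact: closed_openC.
    by case=> x _ xz; apply: nz; exists x.
  have [_ [[x _ <-] [Kx nx]]] := clz _ (filterI zK oz).
  by apply: (Kx x) => // {}Kx; apply: nx; exists x.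
split=> [|P Q [K cK zK] [L cL zL]|P Q PQ [K cK zK]].
- by exists set0; [exact: compact0|exact: filterE].
- exists (K `|` L); first exact: compactU.
  apply: filterS (filterI zK zL) => w [KP LQ] x wx nKL.
  by split; [apply: KP|apply: LQ] => // h; apply: nKL; [left|right].
- by exists K => //; apply: filterS zK => w KP x wx nK; apply/PQ/KP.
Qed.

Lemma boundary_trace_cvg X (z : higson_corona X) :
  @higson_eval R X @ boundary_trace z --> set_val z.
Proof.
move=> U zU; exists set0; first exact: compact0.
by apply: filterS zU => w Uw x wx _; rewrite /= -wx.
Qed.

Lemma boundary_trace_cvg_coord X (z : higson_corona X) (psi : higson X) :
  set_val psi @ boundary_trace z --> set_val z psi.
Proof. exact: (ptws_cvgP _ _).1 (@boundary_trace_cvg X z) psi. Qed.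

Lemma boundary_trace_vanishes X (z : higson_corona X) (g : X -> R) :
  vanishes_at_infinity setT g -> g @ boundary_trace z --> (0 : R).
Proof.
move=> g0; apply/cvgr0Pnorm_lt => e e0; have [K cK hK] := g0 e e0.
by exists K => //; apply: filterE => w x _ nK; exact: hK.
Qed.

Variables (X Y : metricType R) (f : X -> Y).
Hypotheses (pX : proper_metric X) (pY : proper_metric Y) (cf : coarse_map f).

Lemma higson_pullback_ex (phi : higson Y) :
  exists psi : higson X, higson_pullback f phi psi.
Proof.
have [bphi _ /(vanishes_diffP _ pY) sphi] := set_valP phi.
have [||psi hpsi psi0] := @slowly_varying_regularize R X (set_val phi \o f) pX.
- have /bounded_fun_le[C hC] := bphi.
  by apply/bounded_fun_le; exists C => x; exact: hC.
- exact: slowly_varying_comp.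
by exists (SigSub (mem_set hpsi)).
Qed.

(* An arbitrary choice, irrelevant on the corona by [higson_mapE]. *)
Definition higson_pull (phi : higson Y) : higson X :=
  projT1 (cid (higson_pullback_ex phi)).

Lemma higson_pullP phi : higson_pullback f phi (higson_pull phi).
Proof. by rewrite /higson_pull; case: cid. Qed.

Lemma higson_pullback_cvg (z : higson_corona X) phi psi :
  higson_pullback f phi psi ->
  (fun x => set_val phi (f x)) @ boundary_trace z --> set_val z psi.
Proof.
move=> /(boundary_trace_vanishes z) h.
rewrite -[set_val z psi]add0r.
have -> : (fun x => set_val phi (f x)) =
    (fun x => (set_val phi (f x) - set_val psi x) + set_val psi x).
  by apply/funext => x; rewrite subrK.
exact: cvgD h (@boundary_trace_cvg_coord X z psi).
Qed.

Definition higson_map_val (z : higson_corona X) : {ptws higson Y -> R} :=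
  fun phi => set_val z (higson_pull phi).

Lemma higson_map_val_cvg (z : higson_corona X) :
  (@higson_eval R Y \o f) @ boundary_trace z --> higson_map_val z.
Proof.
by apply/ptws_cvgP => phi; apply: higson_pullback_cvg; exact: higson_pullP.
Qed.

Lemma higson_bump (y0 : Y) :
  higson Y (fun y => Num.max 0 (1 - mdist y0 y)).
Proof.
split.
- apply/bounded_fun_le; exists 1 => y; have d0 := mdist_ge0 y0 y.
  by rewrite /Num.max; case: ltP => h; rewrite ger0_norm //; lra.
- move=> x; apply/cvgrPdist_lt => e e0; near=> y.
  have : ball x e y by near: y; exact: nbhsx_ballx.
  rewrite ballEmdist /=; have := metric_triangle y0 x y.
  have := metric_triangle y0 y x; rewrite (metric_sym y x) ltr_norml /Num.max.
  by case: (ltP 0 (1 - mdist y0 x)) => ?; case: (ltP 0 (1 - mdist y0 y)) => ?; lra.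
- apply: (vanishes_diffP (fun y => Num.max 0 (1 - mdist y0 y)) pY).2 => M eps e0.
  exists [set y | mdist y0 y <= 1 + M].
    exists ((1 + M) + (1 + M)) => y y' /= yM y'M.
    by have := metric_triangle y y0 y'; rewrite (metric_sym y y0); lra.
  move=> x y /= /negP; rewrite -ltNge => x0 xy.
  have := metric_triangle y0 y x; rewrite (metric_sym y x).
  have := mdist_ge0 x y.
  by move=> ? ?; rewrite !max_l ?subr0 ?normr0 //; lra.
Unshelve. all: by end_near. Qed.

Lemma higson_map_subproof (z : higson_corona X) :
  higson_boundary Y (higson_map_val z).
Proof.
split.
  move=> U zU; have [x Ux] :=
    @filter_ex _ (boundary_trace z) _ _ (higson_map_val_cvg zU).
  by exists (higson_eval (f x)); split => //; exists (f x).
move=> [y0 _ y0z].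
pose phi : higson Y := SigSub (mem_set (higson_bump y0)).
have phi0 : higson_map_val z phi = 0.
  have h := higson_pullback_cvg (z := z) (@higson_pullP phi).
  suff h0 : vanishes_at_infinity setT (fun x => set_val phi (f x)).
    exact: (cvg_unique (@Rhausdorff R) h (boundary_trace_vanishes z h0)).
  move=> eps e0.
  have [_ fB] := cf; have bB : metric_bounded [set y | mdist y0 y <= 1].
    exists (1 + 1) => y y' /= y1 y'1.
    by have := metric_triangle y y0 y'; rewrite (metric_sym y y0); lra.
  exists (closure (f @^-1` [set y | mdist y0 y <= 1])).
    by apply: proper_compact_closure => //; exact: fB.
  move=> x _ nx; have /negP : ~ (mdist y0 (f x) <= 1).
    by move=> ?; apply: nx; exact: subset_closure.
  by rewrite -ltNge => ?; rewrite set_valE /= max_l ?normr0 //; lra.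
move: phi0; rewrite -y0z /higson_eval set_valE /= mdistxx subr0 max_r ?ler01 //.
by move/eqP; rewrite oner_eq0.
Qed.

Definition higson_map (z : higson_corona X) : higson_corona Y :=
  SigSub (mem_set (higson_map_subproof z)).

Lemma higson_mapE (z : higson_corona X) (phi : higson Y) (psi : higson X) :
  higson_pullback f phi psi ->
  set_val (higson_map z) phi = set_val z psi.
Proof.
move=> /(higson_pullback_cvg (z := z)) h.
have h' := higson_pullback_cvg (z := z) (@higson_pullP phi).
exact: (cvg_unique (@Rhausdorff R) h' h).
Qed.

End HigsonMap.

(* Main.v *)
(* A coarse ultrafilter F has a trace on X: the filter of the sets S such that
   the complement of S is not close to some member of F. By coarse normality it
   is a proper filter depending only on the class of F, it contains the
   complements of bounded sets, and every member of F meets all its elements. A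
   Higson function phi converges along it, because the sets |phi - t| >= e and
   |phi - t| < e/2 are never close. So the evaluation embedding converges to a
   point of the Higson corona, which is the image of the class of F.
   Two classes that are not alike contain sets A, B that are not close, and
   d(x,A) / (1 + d(x,A) + d(x,B)) is then slowly varying: it tells the two limits
   apart. Conversely a point z of the Higson corona in the closure of e(A) is the
   limit of an ultrafilter containing A and all complements of bounded sets, and
   such an ultrafilter is a coarse ultrafilter. Hence the map is bijective and
   sends cl(A) onto the closed set of the boundary points in the closure of e(A).
   Naturality holds because f maps the trace of F to a filter finer than the
   trace of the pushforward of F. *)
From mathcomp Require Import all_boot all_order all_algebra.
From mathcomp Require Import all_classical all_reals all_analysis.
From mathcomp Require Import finmap ring lra.
(* After [all_analysis], whose [close] would otherwise shadow the coarse one. *)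
Require Import Defs.
Set Implicit Arguments.
Unset Strict Implicit.
Unset Printing Implicit Defensive.
Import Order.TTheory GRing.Theory Num.Theory numFieldNormedType.Exports.
Local Open Scope classical_set_scope.
Local Open Scope ring_scope.

(** * Elementary properties of closeness *)

Section Close.
Context {R : realType} {X : metricType R}.
Implicit Types A B : set X.

Lemma closeS A A' B B' : A `<=` A' -> B `<=` B' -> close A B -> close A' B'.
Proof.
move=> AA' BB' [E bE nb]; exists E => // b; apply: nb; apply: metric_boundedS b.
by move=> x [[a /AA' ? ?] [c /BB' ? ?]]; split; [exists a|exists c].
Qed.

Lemma closeU A A' B : close (A `|` A') B -> close A B \/ close A' B.
Proof.
move=> AA'B; apply: contrapT => /not_orP[/closePn nA /closePn nA'].
have /closePn : forall M : R, metric_bounded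
    [set p | exists a b, [/\ (A `|` A') a, B b, mdist p a <= M & mdist p b <= M]].
  move=> M; apply: metric_boundedS (metric_boundedU (nA M) (nA' M)).
  by move=> p [a [b [[Aa|Aa] Bb pa pb]]]; [left|right]; exists a, b.
exact.
Qed.

Lemma bounded_not_close A B : metric_bounded A -> ~ close A B.
Proof.
move=> bA; apply/closePn => M.
apply: metric_boundedS (metric_bounded_nbhd M bA) => p [a [_ [Aa _ pa _]]].
by exists a; rewrite // metric_sym.
Qed.

End Close.

(** * The trace filter of a coarse ultrafilter *)

Section CoarseTrace.
Context {R : realType} {X : metricType R}.
Implicit Types F G : coarse_ultrafilter X.

Lemma cuf_interpolate F (A B : set X) : F B -> ~ close A B ->
  exists2 S, F S & ~ close A S /\ ~ close (~` S) B.
Proof.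
move=> FB /close_separation[S [nAS nSB]]; exists S => //.
have : F (S `|` ~` S) by rewrite setUv; exact: cuf_setT.
by case/cuf_prime => // FS; case: nSB; exact: cuf_close FS FB.
Qed.

(* The trace on [X] of the neighbourhood filter of [corona_class F] in the
   compactification of [X] by its corona. *)
Definition coarse_trace F : set_system X :=
  [set S | exists2 B, F B & ~ close (~` S) B].

Lemma coarse_trace_meets F (A S : set X) :
  F A -> coarse_trace F S -> (A `&` S) !=set0.
Proof.
move=> FA [B FB nSB]; apply: contrapT => /forallNP AS; apply: nSB.
by apply: closeS (cuf_close FA FB) => // x Ax Sx; apply: (AS x).
Qed.

Lemma coarse_trace_cobounded F (B : set X) :
  metric_bounded B -> coarse_trace F (~` B).
Proof.
by move=> bB; exists setT; [exact: cuf_setT|rewrite setCK; exact: bounded_not_close].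
Qed.

#[local] Instance coarse_trace_proper F : ProperFilter (coarse_trace F).
Proof.
split.
  move=> F0; have /(coarse_trace_meets (cuf_setT F)) := F0.
  by case=> x [].
split=> [|S S' [B FB nSB] [B' FB' nSB']|S S' SS' [B FB nSB]].
- exists setT; first exact: cuf_setT.
  by rewrite setCT; apply: bounded_not_close; exists 0 => ? ? [].
(* A coarse ultrafilter need not be closed under intersection, so [B] and [B'] are replaced by [C]
   and [C']: the part of [C] outside [C'] is not close to [B'], hence not in [F], and primality
   leaves the intersection. *)
- have [C FC [nSC _]] := cuf_interpolate FB nSB.
  have [C' FC' [nSC' nCB']] := cuf_interpolate FB' nSB'.
  exists (C `&` C'); last first.
    rewrite setCI => /closeU[]; [apply: contra_not nSC|apply: contra_not nSC'];
      by apply: closeS => // x [].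
  have : F ((C `&` C') `|` (C `&` ~` C')) by rewrite -setIUr setUv setIT.
  case/cuf_prime => // FCC'; case: nCB'.
  by apply: closeS (cuf_close FCC' FB') => // x [].
- by exists B => //; apply: contra_not nSB; apply: closeS => //; exact: subsetC.
Qed.

Lemma coarse_trace_alike F G :
  asymptotically_alike F G -> coarse_trace F = coarse_trace G.
Proof.
wlog suff sub : F G / asymptotically_alike F G -> coarse_trace F `<=` coarse_trace G.
  move=> FG; apply/seteqP; split; apply: sub => //.
  by move=> A B GA FB; apply/closeC/FG.
move=> FG S [B FB nSB]; have [C _ [nSC nCB]] := cuf_interpolate FB nSB.
have : G (C `|` ~` C) by rewrite setUv; exact: cuf_setT.
by case/cuf_prime => GC; [exists C|case: nCB; apply/closeC/FG].
Qed.

(** Whichever side of a separating set lies in [F] serves as the witness. *)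
Lemma coarse_trace_sep F (A B : set X) : ~ close A B ->
  coarse_trace F (~` A) \/ coarse_trace F (~` B).
Proof.
move=> /close_separation[S [nAS nSB]].
have : F (S `|` ~` S) by rewrite setUv; exact: cuf_setT.
case/cuf_prime => FS; [left|right]; [exists S|exists (~` S)] => //;
  by rewrite setCK // => /closeC.
Qed.

(** * Ultrafilters containing all cobounded sets, viewed as coarse ultrafilters *)

Section Ultra.
Variable U : set_system X.
Hypotheses (uU : UltraFilter U)
  (bU : forall B, metric_bounded B -> U (~` B)).

Let ultra_close A B : U A -> U B -> close A B.
Proof.
have pU := @ultra_proper _ _ uU.
move=> UA UB; exists [set p | mdist p.1 p.2 <= 0]; first by exists 0.
(* Members of [U] meet in an unbounded set, so radius 0 already shows closeness. *)
move=> /bU UC.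
have [x [[Ax Bx] ]] := @filter_ex _ _ pU _ (filterI (filterI UA UB) UC).
by apply; split; exists x => //=; rewrite mdistxx.
Qed.

Let ultra_prime A B : U (A `|` B) -> U A \/ U B.
Proof.
have pU := @ultra_proper _ _ uU.
move=> UAB; have [|UA] := in_ultra_setVsetC A uU; first by left.
by right; apply: filterS (filterI UAB UA) => x [[]].
Qed.

Let ultra_setT : U setT.
Proof. by have pU := @ultra_proper _ _ uU; exact: filterT. Qed.

Definition ultra_cuf := CoarseUltrafilter ultra_close ultra_prime ultra_setT.

Lemma ultra_cuf_trace : coarse_trace ultra_cuf `<=` U.
Proof.
move=> S [B UB nSB]; have [//|US] := in_ultra_setVsetC S uU.
by case: nSB; exact: ultra_close.
Qed.

End Ultra.

End CoarseTrace.

(** * The distance function of a nonempty set *)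

Section DistanceToSet.
Context {R : realType} {X : metricType R}.

(* Only meaningful for [A] nonempty: [inf set0 = 0]. *)
Definition dist_set (A : set X) (x : X) : R := inf [set mdist x a | a in A].

Variable A : set X.
Hypothesis A0 : A !=set0.

Let lb x : lbound [set mdist x a | a in A] 0.
Proof. by move=> _ [a _ <-]; exact: mdist_ge0. Qed.

Lemma dist_set_ge0 x : 0 <= dist_set A x.
Proof.
by case: A0 => a Aa; apply: lb_le_inf (@lb x); exists (mdist x a), a.
Qed.

Lemma dist_set_le x a : A a -> dist_set A x <= mdist x a.
Proof. by move=> Aa; apply: ge_inf; [exists 0; exact: lb|exists a]. Qed.

Lemma dist_set_mem x : A x -> dist_set A x = 0.
Proof.
move=> Ax; have := dist_set_le x Ax; rewrite mdistxx => le0.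
by apply/le_anti; rewrite le0 dist_set_ge0.
Qed.

Lemma dist_set_lt x r : dist_set A x < r -> exists2 a, A a & mdist x a < r.
Proof.
move=> xr; have [|_ [a Aa <-] ar] := inf_lt _ xr; last by exists a.
by case: A0 => a Aa; exists (mdist x a), a.
Qed.

Lemma dist_set_lip x y : dist_set A y <= dist_set A x + mdist x y.
Proof.
rewrite -lerBlDr; apply: lb_le_inf.
  by case: A0 => a Aa; exists (mdist x a), a.
move=> _ [a Aa <-]; rewrite lerBlDr (le_trans (dist_set_le y Aa)) //.
by rewrite addrC (metric_sym x y) metric_triangle.
Qed.

End DistanceToSet.

(** * A Higson function separating two sets that are not close *)

Section Urysohn.
Context {R : realType} {X : metricType R}.
Variables (A B : set X).
Hypotheses (A0 : A !=set0) (B0 : B !=set0) (nAB : ~ close A B).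

Let dA := dist_set A.
Let dB := dist_set B.
Let s x := 1 + dA x + dB x.

Let dA0 x : 0 <= dA x := dist_set_ge0 A0 x.
Let dB0 x : 0 <= dB x := dist_set_ge0 B0 x.

(** If [s x <= N], both distances are below [N], and the points within [N] of both [A] and [B] form
    a bounded set. *)
Let s_large N : exists2 K, metric_bounded K & forall x, ~ K x -> N < s x.
Proof.
have /closePn/(_ N) bK := nAB; eexists; first exact: bK.
move=> x nK; rewrite ltNge; apply/negP => sN; apply: nK.
have [|a Aa xa] := @dist_set_lt _ _ A A0 x N.
  by have := dB0 x; move: sN; rewrite /s /dA; lra.
have [|b Bb xb] := @dist_set_lt _ _ B B0 x N.
  by have := dA0 x; move: sN; rewrite /s /dB; lra.
by exists a, b; split => //; exact: ltW.
Qed.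

Let g x := dA x / s x.

Let s_ge1 x : 1 <= s x.
Proof. by rewrite /s; have := dA0 x; have := dB0 x; lra. Qed.

Let s_gt0 x : 0 < s x.
Proof. exact: lt_le_trans (s_ge1 x). Qed.

Let g_slow : slowly_varying g.
Proof.
(* Moving by at most [|M|] changes [s] by at most [2 * |M|], so the second summand keeps [s y] above
   [3 * |M| / e]. *)
move=> M e e0; have [K bK hK] := s_large (3 * `|M| / e + 2 * `|M|).
exists K => // x y /hK sx xy; have M0 := normr_ge0 M.
have xyM : mdist x y <= `|M| := le_trans xy (ler_norm M).
have yxM : mdist y x <= `|M| by rewrite metric_sym.
have a1 := dist_set_lip A0 x y; have a2 := dist_set_lip A0 y x.
have b1 := dist_set_lip B0 x y; have b2 := dist_set_lip B0 y x.
rewrite -/dA -/dB in a1 a2 b1 b2.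
have sx0 := s_gt0 x; have sy0 := s_gt0 y.
have sy : 3 * `|M| / e < s y by move: sx; rewrite /s; lra.
have sye : 3 * `|M| < s y * e by rewrite -ltr_pdivrMr.
have -> : g y - g x =
    ((dA y - dA x) * s x - dA x * (s y - s x)) / (s x * s y).
  by rewrite /g; field; rewrite !gt_eqF.
rewrite normrM normfV (gtr0_norm (mulr_gt0 sx0 sy0)) ltr_pdivrMr ?mulr_gt0 //.
have dAs : dA x <= s x by rewrite /s; have := dB0 x; lra.
have : `|(dA y - dA x) * s x - dA x * (s y - s x)| <= 3 * `|M| * s x.
  apply: le_trans (ler_normB _ _) _; rewrite !normrM (gtr0_norm sx0).
  rewrite (ger0_norm (dA0 x)).
  have h1 : `|dA y - dA x| * s x <= `|M| * s x.
    by rewrite ler_pM2r // ler_norml; apply/andP; split; lra.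
  have h2 : dA x * `|s y - s x| <= s x * (2 * `|M|).
    apply: ler_pM => //; rewrite ler_norml /s; apply/andP; split; lra.
  by lra.
move=> /le_lt_trans; apply.
have -> : e * (s x * s y) = s y * e * s x by ring.
by rewrite ltr_pM2r.
Qed.

Lemma higson_urysohn : proper_metric X ->
  exists psi : higson X, exists2 K, metric_bounded K &
    forall x, ~ K x -> (A x -> set_val psi x < 1 / 8) /\
                       (B x -> 3 / 8 < set_val psi x).
Proof.
move=> pX; have [|psi hpsi psi0] := slowly_varying_regularize pX _ g_slow.
  apply/bounded_fun_le; exists 1 => x.
  rewrite /g ger0_norm ?divr_ge0 // ?(ltW (s_gt0 x)) // ler_pdivrMr // mul1r /s.
  by have := dB0 x; lra.
have e0 : (0 : R) < 1 / 8 by lra.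
have [K' /compact_metric_bounded bK' hK'] := psi0 _ e0.
(* On [B] one has [g = 1 - 1 / s], which exceeds 1/2 once [s] exceeds 2; the error 1/8 of [psi]
   leaves 3/8. *)
have [K bK hK] := s_large 2.
exists (SigSub (mem_set hpsi)), (K `|` K'); first exact: metric_boundedU.
move=> x /not_orP[/hK sx nK']; have := hK' x I nK'.
rewrite set_valE /= ltr_norml => /andP[h1 h2]; split=> [Ax|Bx].
  by move: h1; rewrite /g /dA dist_set_mem // mul0r; lra.
have : 1 / 2 < g x; last by lra.
by rewrite ltr_pdivlMr //; move: sx; rewrite /s /dB (dist_set_mem B0 Bx); lra.
Qed.

End Urysohn.

(** * The map to the Higson corona and its injectivity *)

Section CoronaToHigson.
Context {R : realType} {X : metricType R}.
Hypothesis pX : proper_metric X.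
Implicit Types (F G : coarse_ultrafilter X) (z : higson_corona X).

#[local] Existing Instance coarse_trace_proper.
#[local] Existing Instance boundary_trace_proper.

(** Off a bounded set, a point within [M] of both sets would have a value of [g] within [e / 4] of a
    value in each, which bridges less than the gap [e / 2]. *)
Lemma slowly_varying_not_close (g : X -> R) (t e : R) :
  slowly_varying g -> 0 < e ->
  ~ close [set x | e <= `|g x - t|] [set x | `|g x - t| < e / 2].
Proof.
move=> sg e0; apply/closePn => M; have e40 : 0 < e / 4 by rewrite divr_gt0.
have [K bK hK] := sg M _ e40; apply: metric_boundedS bK.
move=> p [a [b [/= ga gb pa pb]]]; apply: contrapT => nK.
have := hK p a nK pa; have := hK p b nK pb; rewrite !ltr_norml => h1 h2.
move: ga gb; rewrite leNgt => /negP nga; rewrite ltr_norml => gb; apply: nga.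
by rewrite ltr_norml; lra.
Qed.

Lemma coarse_trace_vanishes F (g : X -> R) :
  vanishes_at_infinity setT g -> g @ coarse_trace F --> (0 : R).
Proof.
move=> g0; apply/cvgr0Pnorm_lt => e e0.
have [K /compact_metric_bounded bK hK] := g0 e e0.
by apply: filterS (coarse_trace_cobounded F bK) => x nK; exact: hK.
Qed.

Lemma coarse_trace_cvg_coord F (phi : higson X) :
  exists t : R, set_val phi @ coarse_trace F --> t.
Proof.
have [/bounded_fun_le[C hC] _ /(vanishes_diffP _ pX) sphi] := set_valP phi.
have [|t [_ ct]] := @segment_compact R (- C) C (set_val phi @ coarse_trace F) _.
  apply: (@filterE _ (coarse_trace F)) => x.
  by rewrite /= in_itv /= -ler_norml; exact: hC.
exists t; apply/cvgrPdist_lt => e e0.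
(* The second alternative keeps [phi] away from [t] along the trace, although [t] is a cluster
   point. *)
have [trA|trB] := coarse_trace_sep F (slowly_varying_not_close (t := t) sphi e0).
  by apply: filterS trA => x /= /negP; rewrite -ltNge distrC.
have e20 : 0 < e / 2 by rewrite divr_gt0.
have trB' : (set_val phi @ coarse_trace F) (~` [set r | `|r - t| < e / 2]) := trB.
have [r [/= nr]] := ct _ _ trB' (nbhsx_ballx t (e / 2) e20).
by rewrite -ball_normE /= distrC.
Qed.

Lemma coarse_trace_cvg F :
  exists z : higson_corona X, @higson_eval R X @ coarse_trace F --> set_val z.
Proof.
pose w : {ptws higson X -> R} :=
  fun phi => projT1 (cid (coarse_trace_cvg_coord F phi)).
have Fw : @higson_eval R X @ coarse_trace F --> w.
  by apply/ptws_cvgP => phi; rewrite /w; case: cid.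
suff hw : higson_boundary X w by exists (SigSub (mem_set hw)).
split.
  move=> U wU; have [x Ux] := @filter_ex _ (coarse_trace F) _ _ (Fw _ wU).
  by exists (higson_eval x); split => //; exists x.
(* At an interior point [x0] the bump would have limit 1, but it vanishes off the unit ball, whose
   complement is in the trace. *)
move=> [x0 _ x0w]; pose phi : higson X := SigSub (mem_set (higson_bump pX x0)).
have w1 : w phi = 1.
  by rewrite -x0w /higson_eval set_valE /= mdistxx subr0 max_r ?ler01.
have /cvgrPdist_lt/(_ 1 ltr01) tr1 : set_val phi @ coarse_trace F --> (1 : R).
  by rewrite -w1; exact: (ptws_cvgP _ _).1 Fw phi.
have bB : metric_bounded [set y | mdist x0 y <= 1].
  exists (1 + 1) => y y' /= y1 y'1.
  by have := metric_triangle y x0 y'; rewrite (metric_sym y x0); lra.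
have [x [/negP /= + ]] := filter_ex (filterI (coarse_trace_cobounded F bB) tr1).
by rewrite -ltNge => x1; rewrite set_valE /= max_l ?subr0 ?normr1 ?ltxx //; lra.
Qed.

Definition corona_to_higson (c : coarse_corona X) : higson_corona X :=
  projT1 (cid (coarse_trace_cvg (repr c))).

Lemma corona_to_higsonP F :
  @higson_eval R X @ coarse_trace F --> set_val (corona_to_higson (corona_class F)).
Proof.
rewrite /corona_to_higson; case: cid => z /=.
rewrite (@coarse_trace_alike _ _ _ F) //.
by apply/corona_classP; exact: reprK.
Qed.

Lemma corona_classK (c : coarse_corona X) : corona_class (repr c) = c.
Proof. exact: reprK. Qed.

Lemma higson_cvg_unique (H : set_system X) z z' : ProperFilter H ->
  @higson_eval R X @ H --> set_val z -> @higson_eval R X @ H --> set_val z' ->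
  z = z'.
Proof.
move=> pH hz hz'; apply: val_inj.
have hT := @hausdorff_product (higson X) (fun=> R) (fun=> @Rhausdorff R).
exact: (cvg_unique hT hz hz').
Qed.

Lemma corona_to_higson_coord F (phi : higson X) :
  set_val phi @ coarse_trace F -->
  (set_val (corona_to_higson (corona_class F)) phi : R).
Proof. exact: (ptws_cvgP _ _).1 (@corona_to_higsonP F) phi. Qed.

Lemma corona_to_higson_inj : injective corona_to_higson.
Proof.
move=> c c'; rewrite -[c]corona_classK -[c']corona_classK.
move: (repr c) (repr c') => F G FG; apply/corona_classP => A B FA GB.
apply: contrapT => nAB.
have A0 : A !=set0.
  by have [x [Ax _]] := coarse_trace_meets FA filterT; exists x.
have B0 : B !=set0.
  by have [x [Bx _]] := coarse_trace_meets GB filterT; exists x.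
have [psi [K bK hK]] := higson_urysohn A0 B0 nAB pX.
(* Approximation within 1/8 puts the common limit of [psi] below 1/4 because of [A] and above 1/4
   because of [B]. *)
have e0 : (0 : R) < 1 / 8 by lra.
have := @corona_to_higson_coord F psi.
move=> /cvgrPdist_lt/(_ _ e0) /(filterI (coarse_trace_cobounded F bK)).
move=> /(coarse_trace_meets FA)[x [Ax [/hK[+ _]]]] /=.
have := @corona_to_higson_coord G psi.
move=> /cvgrPdist_lt/(_ _ e0) /(filterI (coarse_trace_cobounded G bK)).
move=> /(coarse_trace_meets GB)[y [By [/hK[_ +]]]] /=.
move=> + + /(_ Ax) => /(_ By).
by rewrite FG !ltr_norml; lra.
Qed.

(** * Images of the closed sets [corona_cl A], and surjectivity *)

Lemma higson_eval_closed_image (K : set X) :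
  compact K -> closed (@higson_eval R X @` K).
Proof.
move=> cK; apply: compact_closed.
  by apply: (@hausdorff_product (higson X) (fun=> R)) => _; exact: Rhausdorff.
apply: continuous_compact cK; apply: continuous_subspaceT.
exact: higson_eval_continuous.
Qed.

(** Otherwise some neighbourhood of [z] meets the image of [A] only inside the image of a compact
    set; that image is closed and misses [z], so it can be removed. *)
Lemma boundary_trace_within_proper (A : set X) z :
  closure (@higson_eval R X @` A) (set_val z) ->
  ProperFilter (within A (boundary_trace z)).
Proof.
move=> clA; split; last exact: within_filter.
move=> [K cK zK]; have [_ nz] : higson_boundary X (set_val z) := set_valP z.
have oz : nbhs (set_val z) (~` (@higson_eval R X @` K)).
  apply: open_nbhs_nbhs; split.
    by apply: closed_openC; exact: higson_eval_closed_image.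
  by case=> x _ xz; apply: nz; exists x.
have [_ [[x Ax <-] [/= Kx nx]]] := clA _ (filterI zK oz).
by apply: (Kx x) => // Kx'; apply: nx; exists x.
Qed.

(** The case [A = setT] gives surjectivity, the general case continuity of the inverse. *)
Lemma corona_to_higson_clE (A : set X) z :
  [set corona_to_higson c | c in corona_cl A] z <->
  closure (@higson_eval R X @` A) (set_val z).
Proof.
split=> [[_ [F FA <-] <-] U zU|clA].
  have [x [Ax Ux]] := coarse_trace_meets FA (corona_to_higsonP zU).
  by exists (higson_eval x); split => //; exists x.
have pG := boundary_trace_within_proper clA.
have [U [uU GU]] := ultraFilterLemma pG.
have bU B : metric_bounded B -> U (~` B).
  move=> bB; apply: GU; exists (closure B); first exact: proper_compact_closure.
  by apply: filterE => w x _ nB _ /subset_closure.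
exists (corona_class (ultra_cuf uU bU)).
  exists (ultra_cuf uU bU) => //; change (U A); apply: GU.
  by exists set0; [exact: compact0|apply: filterE => w x _ _].
have pU := @ultra_proper _ _ uU.
(* [U] refines both the trace of [ultra_cuf] and [boundary_trace z], so both limits are limits along
   [U]. *)
apply: (@higson_cvg_unique U).
  apply: cvg_trans (@corona_to_higsonP _).
  by apply: cvg_app; exact: ultra_cuf_trace.
apply: cvg_trans (@boundary_trace_cvg R X z); apply: cvg_app => S zS.
by apply: GU; apply: filterS zS => x Sx _.
Qed.

Lemma corona_to_higson_surj z : exists c, corona_to_higson c = z.
Proof.
have [clz _] : higson_boundary X (set_val z) := set_valP z.
by have [_] := corona_to_higson_clE setT z => /(_ clz)[c _ <-]; exists c.
Qed.

(** * Continuity in both directions *)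

Lemma corona_cl_closed (A : set X) : closed (corona_cl A).
Proof.
rewrite -[corona_cl A]setCK; apply: open_closedC.
exists [set ~` corona_cl A]; last by rewrite bigcup_set1.
move=> _ ->; exists [fset A]%fset; first by move=> B _; rewrite in_setT.
by rewrite set_fset1 bigcap_set1.
Qed.

Lemma cvg_corona (T : Type) (H : set_system T) (h : T -> coarse_corona X) c :
  Filter H -> (forall A, ~ corona_cl A c -> H (h @^-1` (~` corona_cl A))) ->
  h @ H --> c.
Proof.
move=> FH hA U /= ; rewrite nbhsE => -[_ [[D sD <-] [C DC Cc]] sCU].
have HC : H (h @^-1` C).
  have /sD[E _ EC] := DC; rewrite -EC preimage_bigcap.
  apply: filter_bigI => A EA; apply: hA => clA.
  by move: Cc; rewrite -EC => /(_ _ EA).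
by apply: filterS HC => t Ct; apply: sCU; exists C.
Qed.

Lemma corona_to_higson_continuous : continuous corona_to_higson.
Proof.
move=> c; suff h : set_val (corona_to_higson c') @[c' --> c] -->
    set_val (corona_to_higson c).
  move=> U /= [_ [[W oW <-] Wc] WU].
  have /h : nbhs (set_val (corona_to_higson c)) W by exact: open_nbhs_nbhs.
  by apply: (@filterS _ (nbhs c)) => c1; exact: WU.
have nF : Filter (nbhs (c : coarse_corona X)) := nbhs_filter _.
apply: (@ptws_cvgP _ _ _ _ nF _ _).2 => phi; apply/cvgrPdist_lt => e e0.
set t := set_val (corona_to_higson c) phi.
have e20 : 0 < e / 2 by rewrite divr_gt0.
pose A := [set x | e / 2 <= `|t - set_val phi x|].
have nA : nbhs c (~` corona_cl A).
  apply: open_nbhs_nbhs; split.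
    by apply: closed_openC; exact: corona_cl_closed.
  move=> [F FA Fc].
  have := @corona_to_higson_coord F phi; rewrite Fc => /cvgrPdist_lt/(_ _ e20).
  move=> /(coarse_trace_meets FA)[x [Ax /= xe]].
  by move: Ax; rewrite /A /= leNgt xe.
apply: filterS nA => c' nA; rewrite ltNge; apply/negP => te.
apply: nA; rewrite -[c']corona_classK; exists (repr c') => //=.
have [//|FA] : repr c' A \/ repr c' (~` A).
  by apply: cuf_prime; rewrite setUv; exact: cuf_setT.
have := @corona_to_higson_coord (repr c') phi; rewrite corona_classK.
move=> /cvgrPdist_lt/(_ _ e20) /(coarse_trace_meets FA)[x [/negP]].
rewrite -ltNge /=; move: te.
have := ler_distD (set_val phi x) t (set_val (corona_to_higson c') phi).
by rewrite (distrC (set_val phi x)); lra.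
Qed.

Lemma corona_to_higson_homeo : homeomorphism corona_to_higson.
Proof.
split; first exact: corona_to_higson_continuous.
pose g z := projT1 (cid (corona_to_higson_surj z)).
have gK : cancel g corona_to_higson by move=> z; rewrite /g; case: cid.
exists g; split => // [c|z]; first exact: corona_to_higson_inj.
have nF : Filter (nbhs (z : higson_corona X)) := nbhs_filter _.
apply: (cvg_corona nF) => A nA.
have nz : ~ closure (@higson_eval R X @` A) (set_val z).
  move=> /corona_to_higson_clE[c cA cz]; apply: nA.
  by rewrite -cz (corona_to_higson_inj (gK (corona_to_higson c))).
have : nbhs z (set_val @^-1` (~` closure (@higson_eval R X @` A))).
  apply: (@initial_continuous _ _ set_val).
  by apply: open_nbhs_nbhs; split => //; apply: closed_openC; exact: closed_closure.
apply: filterS => z' nz' cA; apply: nz'; apply/corona_to_higson_clE.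
by exists (g z') => //; exact: gK.
Qed.

End CoronaToHigson.

(** * Naturality and conclusion *)

Lemma coarse_trace_pushforward {R : realType} {X Y : metricType R} (f : X -> Y)
    (cf : coarse_map f) (F : coarse_ultrafilter X) :
  coarse_trace (cuf_pushforward cf F) `<=` f @ coarse_trace F.
Proof.
move=> S [B FB nSB]; exists (f @^-1` B) => //.
by apply: contra_not nSB; exact: coarse_map_close.
Qed.

(** Both [phi]-coordinates are the limit of [phi] after [f] along the trace of [F]: one through the
    pullback [psi], the other through the pushforward. *)
Lemma corona_to_higson_natural {R : realType} {X Y : metricType R}
    (pX : proper_metric X) (pY : proper_metric Y) (f : X -> Y)
    (cf : coarse_map f) (c : coarse_corona X) :
  higson_map pX pY cf (corona_to_higson pX c) =
  corona_to_higson pY (coarse_corona_map cf c).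
Proof.
rewrite -[c]corona_classK coarse_corona_mapE; move: (repr c) => F.
have pF := coarse_trace_proper F.
apply: val_inj; apply/funext => phi.
have [psi fpsi] := higson_pullback_ex pX pY cf phi.
rewrite -set_valE (higson_mapE pX pY cf _ fpsi).
have hX : (fun x => set_val phi (f x)) @ coarse_trace F -->
    (set_val (corona_to_higson pX (corona_class F)) psi : R).
  rewrite -[X in _ --> X]add0r.
  have -> : (fun x => set_val phi (f x)) =
      (fun x => (set_val phi (f x) - set_val psi x) + set_val psi x).
    by apply/funext => x; rewrite subrK.
  apply: cvgD; first exact: coarse_trace_vanishes.
  exact: (@corona_to_higson_coord _ _ pX F psi).
have hY : (fun x => set_val phi (f x)) @ coarse_trace F -->
    (set_val (corona_to_higson pY (corona_class (cuf_pushforward cf F))) phi : R).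
  move=> U /(@corona_to_higson_coord _ _ pY (cuf_pushforward cf F) phi).
  exact: (@coarse_trace_pushforward _ _ _ f cf F).
exact: (cvg_unique (@Rhausdorff R) hX hY).
Qed.

Theorem theoremB (R : realType) :
  (forall X : metricType R, proper_metric X ->
     exists alpha : coarse_corona X -> higson_corona X, homeomorphism alpha) /\
  (forall (X Y : metricType R) (pX : proper_metric X) (pY : proper_metric Y)
     (f : X -> Y) (cf : coarse_map f),
     exists (alpha : coarse_corona X -> higson_corona X)
            (beta : coarse_corona Y -> higson_corona Y),
       [/\ homeomorphism alpha, homeomorphism beta &
           higson_map pX pY cf \o alpha =1 beta \o coarse_corona_map cf]).
Proof.
split=> [X pX|X Y pX pY f cf].
  by exists (corona_to_higson pX); exact: corona_to_higson_homeo.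
exists (corona_to_higson pX), (corona_to_higson pY); split.
- exact: corona_to_higson_homeo.
- exact: corona_to_higson_homeo.
- by move=> c; exact: corona_to_higson_natural.
Qed.
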